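(* It can happen that, for a $\mathscr{V}$-path $\alpha_0,\beta_0,\alpha_1$ in $\mathcal{N}_n$ (with $\mathscr{V}$ the discrete vector field on $\mathcal{N}_n$ constructed in the context), $\alpha_0$ and $\beta_0$ are first paired in $\mathscr{V}_i$ for some $i\ge 3$, while $\alpha_1$ is not the head of an arrow and is first paired in $\mathscr{V}_j$ with $j>i$. Specifically, for $n=5$, consider the graphs on $\{1,2,3,4,5\}$ with edge sets $$\alpha_0=\{(2,4),(4,5),(3,5)\},\quad \beta_0=\{(2,4),(4,5),(3,5),(2,3)\},$$ $$\alpha_1=\{(4,5),(3,5),(2,3)\},\quad \beta_1=\{(4,5),(3,4),(3,5),(2,3)\}.$$ Then $\alpha_0,\beta_0,\alpha_1$ is a $\mathscr{V}$-path, $(\alpha_0,\beta_0)\in\mathscr{V}_3\setminus\mathscr{V}_{12}$, $\alpha_1$ is not the head of an arrow in $\mathscr{V}$, and $(\alpha_1,\beta_1)\in\mathscr{V}_4\setminus\mathscr{V}_3$.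
   Context: Graphs. A graph of order $n$ is a simple, undirected, labelled graph on the vertex set $\{1,\ldots,n\}$; it is identified with its edge set $E(G)$, a set of 2-subsets of $\{1,\ldots,n\}$. The edge joining $i$ and $j$ is written $(i,j)=(j,i)$. If $(i,j)\notin E(G)$, then $G+(i,j)$ is the graph of order $n$ with edge set $E(G)\cup\{(i,j)\}$. The complex. $\mathcal{N}_n$ is the abstract simplicial complex whose simplices are the (edge sets of) disconnected graphs of order $n$ (the empty set is included as a simplex); the dimension of a simplex $\sigma$ is $|\sigma|-1$. Discrete vector fields. A discrete vector field on a complex $\mathcal{K}$ is a collection $\mathscr{W}$ of ordered pairs $(\alpha,\beta)$ of simplices of $\mathcal{K}$ with $\alpha\subsetneq\beta$ and $\dim\beta=\dim\alpha+1$, such that each simplex of $\mathcal{K}$ is in at most one pair. If $(\alpha,\beta)\in\mathscr{W}$, then $\beta$ is called the head of an arrow in $\mathscr{W}$ (and $\alpha$ the tail). A simplex is unpaired in $\mathscr{W}$ if it is in no pair of $\mathscr{W}$. A $\mathscr{W}$-path is a sequence of simplices $\alpha_0^{(d)},\beta_0^{(d+1)},\alpha_1^{(d)},\ldots,\alpha_k^{(d)},\beta_k^{(d+1)},\alpha_{k+1}^{(d)}$ (superscripts denote dimension) such that for each $i\in\{0,\ldots,k\}$, $(\alpha_i,\beta_i)\in\mathscr{W}$ and $\beta_i\supsetneq\alpha_{i+1}\neq\alpha_i$. Construction of $\mathscr{V}$. Put $$\mathscr{V}_2:=\mathscr{V}_{12}:=\{(G,G+(1,2)) : G\in\mathcal{N}_n,\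 (1,2)\notin E(G),\ G+(1,2)\in\mathcal{N}_n\}.$$ For $i=3,4,\ldots,n$ in increasing order, $\mathscr{V}_i$ is obtained from $\mathscr{V}_{i-1}$ by adding all pairs $(G,G+(j,i))$ with $1\le j<i$, $(j,i)\notin E(G)$, such that $G$ and $G+(j,i)$ both belong to $\mathcal{N}_n$ and are both unpaired in $\mathscr{V}_{i-1}$ (for a given $G$ unpaired in $\mathscr{V}_{i-1}$ there is at most one such $j$). Finally $\mathscr{V}:=\mathscr{V}_n$. A simplex (or pair) is first paired in $\mathscr{V}_i$ ($i\ge3$) if it is paired in $\mathscr{V}_i$ but not in $\mathscr{V}_{i-1}$. *)

(* Defs.v *)
From mathcomp Require Import all_boot all_order all_algebra.

Set Implicit Arguments.
Unset Strict Implicit.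
Unset Printing Implicit Defensive.

(* Discrete vector fields on a finite complex, given as the set of its
   simplices (the empty one included). *)
Section DiscreteVectorFields.
Variable T : finType.
Implicit Types (K : {set {set T}}) (W : {set {set T} * {set T}}).

(* The empty simplex has dimension -1. *)
Definition dim (s : {set T}) : int := (#|s|%:Z - 1)%R.

Definition paired W (s : {set T}) : bool :=
  [exists p in W, (p.1 == s) || (p.2 == s)].

Definition is_head W (s : {set T}) : bool :=
  [exists p in W, p.2 == s].

(* The path alpha_0, beta_0, ..., alpha_k, beta_k, alpha_(k+1) is given by the
   sequences [:: alpha_0; ...; alpha_(k+1)] and [:: beta_0; ...; beta_k];
   size beta = k + 1 is positive since k >= 0. *)
Definition Wpath K W (alpha beta : seq {set T}) : Prop :=
  [/\ (0 < size beta) && (size alpha == (size beta).+1),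
      {subset alpha <= K} /\ {subset beta <= K},
      exists d : int, {in alpha, forall s, dim s = d} /\
                      {in beta, forall s, dim s = (d + 1)%R}
    & forall i, i < size beta ->
      let a := nth set0 alpha i in
      let b := nth set0 beta i in
      let a' := nth set0 alpha i.+1 in
      [/\ (a, b) \in W, a' \proper b & a' != a]].

End DiscreteVectorFields.

(* The vertex labelled k, for 1 <= k <= n, is the ordinal k - 1 of 'I_n.  A
   graph of order n is its edge set, a set of 2-subsets of 'I_n. *)
Definition is_graph n (G : {set {set 'I_n}}) : bool :=
  [forall e in G, #|e| == 2].

(* The edge (a, b) between the vertices with labels a and b.  If a = b or a
   label is not in {1, ..., n}, this is not a 2-subset, so no graph of order n
   contains it. *)
Definition edge n (a b : nat) : {set 'I_n} :=
  [set v : 'I_n | (v.+1 == a) || (v.+1 == b)].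

Definition adj n (G : {set {set 'I_n}}) : rel 'I_n :=
  fun u v => [set u; v] \in G.

Definition connected n (G : {set {set 'I_n}}) : bool :=
  [forall u, forall v, connect (adj G) u v].

Definition NN n : {set {set {set 'I_n}}} :=
  [set G | is_graph G && ~~ connected G].

Definition VV12 n : {set {set {set 'I_n}} * {set {set 'I_n}}} :=
  [set p : {set {set 'I_n}} * {set {set 'I_n}} |
     [&& p.1 \in NN n, edge n 1 2 \notin p.1,
         p.2 == edge n 1 2 |: p.1 & p.2 \in NN n]].

(* The labels j with 1 <= j < i are the nonzero elements of 'I_i. *)
Definition new_pairs n (i : nat) (W : {set {set {set 'I_n}} * {set {set 'I_n}}})
    : {set {set {set 'I_n}} * {set {set 'I_n}}} :=
  [set p : {set {set 'I_n}} * {set {set 'I_n}} | [exists j : 'I_i,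
     [&& 0 < j, edge n j i \notin p.1, p.2 == edge n j i |: p.1,
         p.1 \in NN n, p.2 \in NN n, ~~ paired W p.1 & ~~ paired W p.2]]].

(* VV n i is the stage V_i of the construction, for 2 <= i <= n; the values at
   i = 0, 1 are irrelevant. *)
Fixpoint VV n (i : nat) : {set {set {set 'I_n}} * {set {set 'I_n}}} :=
  if i is i'.+1 then
    if i' < 2 then VV12 n else VV n i' :|: new_pairs i (VV n i')
  else VV12 n.

Definition VVfinal n := VV n n.

Definition first_paired n (i : nat) (s : {set {set 'I_n}}) : bool :=
  [&& 3 <= i, paired (VV n i) s & ~~ paired (VV n i.-1) s].

(* Main.v *)
Require Import Defs.
From mathcomp Require Import all_boot all_order all_algebra.

Set Implicit Arguments.
Unset Strict Implicit.
Unset Printing Implicit Defensive.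

(* In each of the four graphs, vertex 1 is isolated and {2, 3, 4, 5} is
   connected, so adding an edge at 1 gives a connected graph and none of the
   four is paired in V_12.  Removing (2,3) from alpha_1 or beta_1 isolates 2 as
   well, so the result is paired in V_12 by the edge (1,2); hence (2,3) pairs
   neither alpha_1 nor beta_1 in V_3.  In V_4 the edge (2,4) is not available
   to alpha_1 because alpha_1 + (2,4) = beta_0 is already paired in V_3, so
   alpha_1 is paired with beta_1 = alpha_1 + (3,4). *)

(** * Graphs given by lists of labelled edges, with computable tests *)

Definition mkgraph n (s : seq (nat * nat)) : {set {set 'I_n}} :=
  [set e in [seq edge n p.1 p.2 | p <- s]].

(** Comparing incidence label by label decides equality of edges by computation, whatever the
    orientation of the pairs. *)
Definition same_edge n (p q : nat * nat) : bool :=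
  all (fun k => ((k == p.1) || (k == p.2)) == ((k == q.1) || (k == q.2)))
      (iota 1 n).

Definition proper_edge n (p : nat * nat) : bool :=
  [&& 0 < p.1 <= n, 0 < p.2 <= n & p.1 != p.2].

Definition label_nbrs (s : seq (nat * nat)) (S : seq nat) : seq nat :=
  [seq p.2 | p <- s & p.1 \in S] ++ [seq p.1 | p <- s & p.2 \in S].

(** Search from vertex 1; [n] rounds are enough to follow any path without repeated vertices. *)
Definition reach n (s : seq (nat * nat)) : seq nat :=
  iter n (fun S => S ++ label_nbrs s S) [:: 1].

Lemma edge_eq n a b c d :
  (edge n a b == edge n c d) = same_edge n (a, b) (c, d).
Proof.
apply/eqP/allP => [/setP E k | E].
  rewrite mem_iota add1n ltnS => /andP[]; case: k => // k _ kn.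
  by have := E (Ordinal kn); rewrite !inE => /= ->.
by apply/setP => v; rewrite !inE; apply/eqP/E; rewrite mem_iota add1n !ltnS ltn_ord.
Qed.

Lemma mem_mkgraph n s a b :
  (edge n a b \in mkgraph n s) = has (same_edge n (a, b)) s.
Proof.
rewrite inE; elim: s => //= -[c d] s IHs.
by rewrite inE IHs edge_eq.
Qed.

Lemma mkgraph_cons n p s : mkgraph n (p :: s) = edge n p.1 p.2 |: mkgraph n s.
Proof. by apply/setP => e; rewrite !inE. Qed.

(** The filter drops every pair that names the edge, reversed and repeated ones included, so the
    edge really disappears. *)
Lemma mkgraphD1 n s a b :
  mkgraph n s :\ edge n a b =
  mkgraph n [seq p <- s | ~~ same_edge n (a, b) p].
Proof.
apply/setP => e; rewrite !inE; elim: s => [|[c d] s IHs] /=.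
  by rewrite andbF.
rewrite inE andb_orr IHs -edge_eq.
case: (eqVneq (edge n a b) (edge n c d)) => [-> | ne] /=.
  by rewrite andNb.
by rewrite inE; case: (eqVneq e (edge n c d)) => [->|]; rewrite ?andbF // eq_sym ne.
Qed.

Lemma edgeE n (u v : 'I_n) : [set u; v] = edge n u.+1 v.+1.
Proof. by apply/setP => w; rewrite !inE !eqSS. Qed.

Lemma edgeC n a b : edge n a b = edge n b a.
Proof. by apply/setP => v; rewrite !inE orbC. Qed.

Lemma is_graph_mkgraph n s : all (proper_edge n) s -> is_graph (mkgraph n s).
Proof.
move=> /allP ok; apply/forall_inP => e; rewrite inE => /mapP[[a b] /ok].
case/and3P; case: a b => [|a] [|b] //= an bn ab ->.
by rewrite -(edgeE (Ordinal an) (Ordinal bn)) cards2 -(inj_eq val_inj) /= -eqSS ab.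
Qed.

(** By induction on the rounds, every label reached belongs to a vertex connected to [ord0], the
    vertex labelled 1; symmetry of adjacency then links any two vertices. *)
Lemma connected_mkgraph n s :
    all (proper_edge n.+1) s ->
    all (mem (reach n.+1 s)) (iota 1 n.+1) ->
  connected (mkgraph n.+1 s).
Proof.
move=> /allP ok /allP all_reached.
pose r := adj (mkgraph n.+1 s).
have r_sym : symmetric r by move=> u v; rewrite /r /adj setUC.
have edge_r (a b : nat) (u v : 'I_n.+1) : u.+1 = a -> v.+1 = b ->
    (a, b) \in s \/ (b, a) \in s -> r u v.
  move=> <- <- ins; rewrite /r /adj edgeE inE.
  by apply/mapP; case: ins => ins; [exists (u.+1, v.+1) | exists (v.+1, u.+1)];
    rewrite //= edgeC.
have reachP k (v : 'I_n.+1) :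
    v.+1 \in iter k (fun S => S ++ label_nbrs s S) [:: 1] -> connect r ord0 v.
  elim: k v => [|k IHk] v /=.
    by rewrite inE eqSS => /eqP v0; rewrite (_ : v = ord0) //; apply: val_inj.
  rewrite !mem_cat => /or3P[/IHk // | |] /mapP[[a b]];
    rewrite mem_filter /= => /andP[inS ins] vE.
    have /and3P[/= aP _ _] := ok _ ins; case: a aP inS ins => // a an inS ins.
    apply: connect_trans (IHk (Ordinal an) inS) (connect1 _).
    by apply: edge_r (erefl _) vE _; left.
  have /and3P[/= _ bP _] := ok _ ins; case: b bP inS ins => // b bn inS ins.
  apply: connect_trans (IHk (Ordinal bn) inS) (connect1 _).
  by apply: edge_r (erefl _) vE _; right.
have from0 v : connect r ord0 v.
  by apply/(reachP n.+1)/all_reached; rewrite mem_iota add1n /= ltnS ltn_ord.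
apply/forallP => u; apply/forallP => v.
by apply: connect_trans (from0 v); rewrite (sym_connect_sym r_sym).
Qed.

(** No edge crosses the boundary of [S], so [S] is closed under adjacency and no path leads from [u]
    to [v]. *)
Lemma disconnected_mkgraph n s (S : seq nat) (u v : 'I_n) :
    all (fun p => (p.1 \in S) == (p.2 \in S)) s ->
    all (proper_edge n) s -> u.+1 \in S -> v.+1 \notin S ->
  ~~ connected (mkgraph n s).
Proof.
move=> /allP closedS /allP ok uS vS.
apply/negP => /forallP/(_ u)/forallP/(_ v).
have clos : closed (adj (mkgraph n s)) [pred x : 'I_n | x.+1 \in S].
  move=> x y; rewrite /adj edgeE inE => /mapP[[a b] ins /eqP].
  have /and3P[/= aP bP _] := ok _ ins; have /eqP := closedS _ ins.
  case: a aP ins => [|a] //= an ins; case: b bP ins => [|b] //= bn ins ab.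
  rewrite -(edgeE x y) -(edgeE (Ordinal an) (Ordinal bn)) => /eqP/setP xy.
  (* Testing the equality of edges at [x] and at [y] shows that each is an endpoint of the listed
     edge, whose endpoints lie on the same side of [S]. *)
  have := xy x; have := xy y; rewrite !inE !eqxx orbT /=.
  by move=> /esym/orP[]/eqP-> /esym/orP[]/eqP->; rewrite ?inE /= ?ab.
by move=> /(closed_connect clos); rewrite !inE uS (negPf vS).
Qed.

Lemma NN_mkgraph n s (S : seq nat) (u v : 'I_n) :
    all (fun p => (p.1 \in S) == (p.2 \in S)) s ->
    all (proper_edge n) s -> u.+1 \in S -> v.+1 \notin S ->
  mkgraph n s \in NN n.
Proof.
move=> cl ok uS vS; rewrite inE is_graph_mkgraph //=.
exact: disconnected_mkgraph uS vS.
Qed.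

Lemma notin_NN_mkgraph n s :
    all (proper_edge n.+1) s && all (mem (reach n.+1 s)) (iota 1 n.+1) ->
  mkgraph n.+1 s \notin NN n.+1.
Proof. by case/andP=> ok r; rewrite inE negb_and negbK connected_mkgraph ?orbT. Qed.

(** * Paired simplices and heads in a vector field *)

Section VectorFields.
Variable T : finType.
Implicit Types (W : {set {set T} * {set T}}) (a b s : {set T}).

Lemma pairedU W1 W2 s :
  paired (W1 :|: W2) s = paired W1 s || paired W2 s.
Proof.
apply/exists_inP/orP => [[p] | [] /exists_inP[p pW ps]].
- by rewrite inE => /orP[] pW ps; [left | right]; apply/exists_inP; exists p.
- by exists p; rewrite // inE pW.
- by exists p; rewrite // inE pW orbT.
Qed.

Lemma is_headU W1 W2 s :
  is_head (W1 :|: W2) s = is_head W1 s || is_head W2 s.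
Proof.
apply/exists_inP/orP => [[p] | [] /exists_inP[p pW ps]].
- by rewrite inE => /orP[] pW ps; [left | right]; apply/exists_inP; exists p.
- by exists p; rewrite // inE pW.
- by exists p; rewrite // inE pW orbT.
Qed.

Lemma paired_tail W a b :
  (a, b) \in W -> paired W a.
Proof. by move=> abW; apply/exists_inP; exists (a, b); rewrite //= eqxx. Qed.

Lemma paired_head W a b :
  (a, b) \in W -> paired W b.
Proof. by move=> abW; apply/exists_inP; exists (a, b); rewrite //= eqxx orbT. Qed.

Lemma is_head_paired W s :
  is_head W s -> paired W s.
Proof. by case/exists_inP=> p pW ps; apply/exists_inP; exists p; rewrite // ps orbT. Qed.

End VectorFields.

(** * Criteria for being paired at a given stage *)

Section Construction.
Variable n : nat.
Implicit Types (G : {set {set 'I_n}})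
  (W : {set {set {set 'I_n}} * {set {set 'I_n}}}).

Lemma VV_succ i : 1 < i -> VV n i.+1 = VV n i :|: new_pairs i.+1 (VV n i).
Proof. by move=> i1 /=; rewrite ltnNge i1. Qed.

Lemma paired_VV12 G :
  edge n 1 2 \notin G -> G \in NN n -> edge n 1 2 |: G \in NN n ->
  paired (VV12 n) G.
Proof.
move=> eG GN HN; apply: (@paired_tail _ _ _ (edge n 1 2 |: G)).
by rewrite inE /= eG GN HN eqxx.
Qed.

(** One condition excludes both roles: a head already contains (1,2), so adding that edge would give
    back the head itself, which lies in [NN n]. *)
Lemma unpaired_VV12 G : edge n 1 2 |: G \notin NN n -> ~~ paired (VV12 n) G.
Proof.
move=> GN; apply/exists_inP => -[[a b]]; rewrite inE /= => /and4P[_ _ /eqP-> bN].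
by case/orP=> /eqP E; move: GN; rewrite -E ?setUA ?setUid bN.
Qed.

Lemma mem_new_pairs i j W G :
    0 < j < i -> edge n j i \notin G ->
    G \in NN n -> edge n j i |: G \in NN n ->
    ~~ paired W G -> ~~ paired W (edge n j i |: G) ->
  (G, edge n j i |: G) \in new_pairs i W.
Proof.
move=> /andP[j0 ji] eG GN HN GW HW; rewrite inE; apply/existsP.
by exists (Ordinal ji); rewrite /= j0 eG GN HN GW HW eqxx.
Qed.

(** The only possible partner of [G] through (j,i) is [G] with that edge toggled: [G] would be the
    head if it contains the edge, and the tail otherwise. *)
Lemma unpaired_new_pairs i W G :
    (forall j, 0 < j < i -> if edge n j i \in G
       then paired W (G :\ edge n j i)
       else (edge n j i |: G \notin NN n) || paired W (edge n j i |: G)) ->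
  ~~ paired (new_pairs i W) G.
Proof.
move=> blocked; apply/exists_inP => -[[a b]]; rewrite inE /= => /existsP[j].
move=> /and5P[j0 ea /eqP-> aN /and3P[bN aW bW]].
have := blocked j; rewrite j0 ltn_ord => /(_ isT) blk.
case/orP=> /eqP E; move: blk; rewrite -E;
  first by rewrite (negPf ea) bN (negPf bW).
by rewrite setU11 setU1K // (negPf aW).
Qed.

(** Each stage pairs only simplices left unpaired before it. *)
Lemma not_head_paired_new_pairs i W G : paired W G -> ~~ is_head (new_pairs i W) G.
Proof.
move=> GW; apply/exists_inP => -[[a b]]; rewrite inE /= => /existsP[j].
by case/and5P=> _ _ _ _ /and3P[_ _ bW] /eqP bG; move: bW; rewrite bG GW.
Qed.

Lemma not_head_new_pairs i W G :
  (forall j, 0 < j < i -> edge n j i \notin G) -> ~~ is_head (new_pairs i W) G.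
Proof.
move=> noe; apply/exists_inP => -[[a b]]; rewrite inE /= => /existsP[j].
case/and5P=> j0 _ /eqP-> _ _ /eqP E; have := noe j; rewrite j0 ltn_ord => /(_ isT).
by rewrite -E setU11.
Qed.

End Construction.

Lemma card_mkgraph_cons n p s :
  ~~ has (same_edge n p) s -> #|mkgraph n (p :: s)| = #|mkgraph n s|.+1.
Proof. by case: p => a b ps; rewrite mkgraph_cons cardsU1 mem_mkgraph ps. Qed.

Lemma card_mkgraph_nil n : #|mkgraph n [::]| = 0.
Proof. by apply: eq_card0 => e; rewrite !inE. Qed.

(** * The four graphs of order 5 *)

Definition alpha0 := mkgraph 5 [:: (2, 4); (4, 5); (3, 5)].
(** In [beta0] and [beta1] the edge added by the arrow comes first, so that [mkgraph_cons] splits it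
    off. *)
Definition beta0 := mkgraph 5 [:: (2, 3); (2, 4); (4, 5); (3, 5)].
Definition alpha1 := mkgraph 5 [:: (4, 5); (3, 5); (2, 3)].
Definition beta1 := mkgraph 5 [:: (3, 4); (4, 5); (3, 5); (2, 3)].

(** The separating set consists of label 1; [inord 0] and [inord 1] are the vertices labelled 1 and
    2. *)
Ltac isolated1 :=
  by apply: (@NN_mkgraph 5 _ [:: 1] (inord 0) (inord 1)); rewrite ?inordK.
Ltac isolated12 :=
  by apply: (@NN_mkgraph 5 _ [:: 1; 2] (inord 0) (inord 2)); rewrite ?inordK.

Lemma alpha0_NN : alpha0 \in NN 5. Proof. isolated1. Qed.
Lemma beta0_NN : beta0 \in NN 5. Proof. isolated1. Qed.
Lemma alpha1_NN : alpha1 \in NN 5. Proof. isolated1. Qed.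
Lemma beta1_NN : beta1 \in NN 5. Proof. isolated1. Qed.

Lemma beta0E : beta0 = edge 5 2 3 |: alpha0.
Proof. exact: mkgraph_cons. Qed.

Lemma beta1E : beta1 = edge 5 3 4 |: alpha1.
Proof. exact: mkgraph_cons. Qed.

(** This makes [alpha1] a facet of [beta0], as the last step of the path requires. *)
Lemma beta0E_alpha1 : beta0 = edge 5 2 4 |: alpha1.
Proof. by apply/setP => e; rewrite !inE; do 4!case: (e == _). Qed.

Ltac joined := rewrite -(mkgraph_cons _ (_, _)) notin_NN_mkgraph.

Lemma unpaired2_alpha0 : ~~ paired (VV12 5) alpha0.
Proof. by apply: unpaired_VV12; joined. Qed.
Lemma unpaired2_beta0 : ~~ paired (VV12 5) beta0.
Proof. by apply: unpaired_VV12; joined. Qed.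
Lemma unpaired2_alpha1 : ~~ paired (VV12 5) alpha1.
Proof. by apply: unpaired_VV12; joined. Qed.
Lemma unpaired2_beta1 : ~~ paired (VV12 5) beta1.
Proof. by apply: unpaired_VV12; joined. Qed.

Lemma alpha0_beta0_new : (alpha0, beta0) \in new_pairs 3 (VV12 5).
Proof.
rewrite beta0E; apply: mem_new_pairs; rewrite -?beta0E //.
- by rewrite mem_mkgraph.
- exact: alpha0_NN.
- exact: beta0_NN.
- exact: unpaired2_alpha0.
- exact: unpaired2_beta0.
Qed.

Lemma VV3 : VV 5 3 = VV12 5 :|: new_pairs 3 (VV12 5).
Proof. exact: VV_succ. Qed.

Lemma alpha0_beta0_VV3 : (alpha0, beta0) \in VV 5 3.
Proof. by rewrite VV3 inE alpha0_beta0_new orbT. Qed.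

(** The labels 1 and 2 are cut off from the rest both before and after (1,2) is added. *)
Ltac paired2 := apply: paired_VV12;
  [by rewrite mem_mkgraph | | rewrite -(mkgraph_cons _ (_, _))]; isolated12.

Lemma unpaired3_alpha1 : ~~ paired (VV 5 3) alpha1.
Proof.
rewrite VV3 pairedU negb_or unpaired2_alpha1.
(* Two cases remain: for j = 1, adding (1,3) connects the graph; for j = 2, the edge (2,3) is
   present and has to be removed. *)
apply: unpaired_new_pairs => -[|[|[|j]]] //= _; rewrite mem_mkgraph /=.
  by joined.
by rewrite mkgraphD1; paired2.
Qed.

Lemma unpaired3_beta1 : ~~ paired (VV 5 3) beta1.
Proof.
rewrite VV3 pairedU negb_or unpaired2_beta1.
apply: unpaired_new_pairs => -[|[|[|j]]] //= _; rewrite mem_mkgraph /=.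
  by joined.
by rewrite mkgraphD1; paired2.
Qed.

Lemma alpha1_beta1_VV4 : (alpha1, beta1) \in VV 5 4.
Proof.
rewrite VV_succ // inE; apply/orP; right.
rewrite beta1E; apply: mem_new_pairs; rewrite -?beta1E //.
- by rewrite mem_mkgraph.
- exact: alpha1_NN.
- exact: beta1_NN.
- exact: unpaired3_alpha1.
- exact: unpaired3_beta1.
Qed.

(** Stage 5 adds no pair containing [alpha1], which is paired in [VV 5 4]; up to stage 3 it is
    unpaired; and a head added at stage 4 contains some (j,4) with j < 4, whereas the only edge of
    [alpha1] at 4 is (4,5). *)
Lemma not_head_alpha1 : ~~ is_head (VVfinal 5) alpha1.
Proof.
rewrite /VVfinal (@VV_succ 5 4) // is_headU negb_or.
rewrite (not_head_paired_new_pairs _ (paired_tail alpha1_beta1_VV4)) andbT.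
rewrite VV_succ // is_headU negb_or.
rewrite (contra (@is_head_paired _ _ _) unpaired3_alpha1).
by apply: not_head_new_pairs => -[|[|[|[|j]]]] //= _; rewrite mem_mkgraph.
Qed.

Lemma Wpath_alpha0_alpha1 :
  Wpath (NN 5) (VVfinal 5) [:: alpha0; alpha1] [:: beta0].
Proof.
split => //.
- by split=> s; rewrite !in_cons orbF; do ?[case/orP]; move=> /eqP->;
    rewrite ?alpha0_NN ?alpha1_NN ?beta0_NN.
(* Three edges give dimension 2, four edges dimension 3. *)
- exists (Posz 2); rewrite /Defs.dim.
  by split=> s; rewrite !in_cons orbF; do ?[case/orP]; move=> /eqP->;
    rewrite /alpha0 /alpha1 /beta0 !card_mkgraph_cons ?card_mkgraph_nil.
- case=> //= _; split.
  + by rewrite /VVfinal (@VV_succ 5 4) // (@VV_succ 5 3) // 2!in_setU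
      alpha0_beta0_VV3.
  (* The edge (2,4), in [alpha0] and [beta0] but not in [alpha1], witnesses both the proper
     inclusion and the inequality. *)
  + rewrite beta0E_alpha1 properE subsetUr.
    by apply/subsetPn; exists (edge 5 2 4); rewrite ?setU11 ?mem_mkgraph.
  + apply/eqP => /setP/(_ (edge 5 2 4)); by rewrite !mem_mkgraph.
Qed.

Theorem mainTheorem2 :
  (exists (n : nat) (alpha0 beta0 alpha1 : {set {set 'I_n}}) (i j : nat),
     [/\ 3 <= i, i < j & j <= n] /\
     [/\ Wpath (NN n) (VVfinal n) [:: alpha0; alpha1] [:: beta0],
         first_paired i alpha0,
         first_paired i beta0,
         ~~ is_head (VVfinal n) alpha1
       & first_paired j alpha1])
  /\
  (let alpha0 := [set edge 5 2 4; edge 5 4 5; edge 5 3 5] in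
   let beta0 := [set edge 5 2 4; edge 5 4 5; edge 5 3 5; edge 5 2 3] in
   let alpha1 := [set edge 5 4 5; edge 5 3 5; edge 5 2 3] in
   let beta1 := [set edge 5 4 5; edge 5 3 4; edge 5 3 5; edge 5 2 3] in
   [/\ Wpath (NN 5) (VVfinal 5) [:: alpha0; alpha1] [:: beta0],
       (alpha0, beta0) \in VV 5 3 :\: VV12 5,
       ~~ is_head (VVfinal 5) alpha1
     & (alpha1, beta1) \in VV 5 4 :\: VV 5 3]).
Proof.
split.
  exists 5, alpha0, beta0, alpha1, 3, 4; split=> //; split.
  - exact: Wpath_alpha0_alpha1.
  - by rewrite /first_paired (paired_tail alpha0_beta0_VV3) unpaired2_alpha0.
  - by rewrite /first_paired (paired_head alpha0_beta0_VV3) unpaired2_beta0.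
  - exact: not_head_alpha1.
  - by rewrite /first_paired (paired_tail alpha1_beta1_VV4) unpaired3_alpha1.
move=> a0 b0 a1 b1.
(* The explicit sets and the edge lists differ at most in order and nesting, so membership of an
   arbitrary [e] reduces to a Boolean identity. *)
have -> : a0 = alpha0 by apply/setP => e; rewrite !inE; do 3!case: (e == _).
have -> : b0 = beta0 by apply/setP => e; rewrite !inE; do 4!case: (e == _).
have -> : a1 = alpha1 by apply/setP => e; rewrite !inE; do 3!case: (e == _).
have -> : b1 = beta1 by apply/setP => e; rewrite !inE; do 4!case: (e == _).
split.
- exact: Wpath_alpha0_alpha1.
- rewrite in_setD alpha0_beta0_VV3 andbT.
  exact: contra (@paired_tail _ _ _ _) unpaired2_alpha0.
- exact: not_head_alpha1.
- rewrite in_setD alpha1_beta1_VV4 andbT.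
  exact: contra (@paired_tail _ _ _ _) unpaired3_alpha1.
Qed.
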